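(* Let $G$ be a locally compact, Hausdorff and r-discrete groupoid with non-compact unit space $G^{(0)}$, and let $G^{(0)}_+=G^{(0)}\cup\{\infty\}$ denote the Alexandrov one-point compactification of $G^{(0)}$. Set $\widetilde G=G\cup\{\infty\}$, $\widetilde G^{(2)}=G^{(2)}\cup\{(\infty,\infty)\}$ and $\widetilde G^{(0)}=G^{(0)}_+$. Define composition of pairs in $G^{(2)}\subset\widetilde G^{(2)}$ as in $G$ (and $\infty\infty=\infty$), and extend $r$ and $s$ to $\widetilde G$ by setting $r^{-1}(\infty)=s^{-1}(\infty)=\{\infty\}$. Then the collection $\mathfrak U$ consisting of $\widetilde G$, all open sets in $G^{(0)}_+$ and all open sets in $G$ is a basis for a topology on $\widetilde G$. Equipped with this topology, $\widetilde G$ is a locally compact, Hausdorff and r-discrete groupoid with compact unit space $\widetilde G^{(0)}$, and it contains $G$ as a subgroupoid. If in addition $G$ is étale, then so is $\widetilde G$.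
   Context: For a topological groupoid $G$ with unit space $G^{(0)}$ and set of composable pairs $G^{(2)}=\{(g,h): s(g)=r(h)\}$, $r(g)=gg^{-1}$ and $s(g)=g^{-1}g$. $G$ is r-discrete if $G^{(0)}$ is open in $G$, and étale if $r$ is a local homeomorphism. The point $\infty$ is a unit of $\widetilde G$, so $\infty^{-1}=\infty$. The topology of $G^{(0)}_+$ consists of the open sets of $G^{(0)}$ together with the sets $(G^{(0)}\setminus K)\cup\{\infty\}$ with $K\subset G^{(0)}$ closed and compact. *)

(* Defs.v *)
From HB Require Import structures.
From mathcomp Require Import all_boot all_classical topology.

Set Implicit Arguments.
Unset Strict Implicit.
Unset Printing Implicit Defensive.

Local Open Scope classical_set_scope.

(** * Groupoids *)

(** The product is a total function of which only the values on composable
    pairs are meaningful. *)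
Record groupoid_data (T : Type) := GroupoidData {
  composable : set (T * T);
  mul : T -> T -> T;
  inv : T -> T }.

Section Groupoid.
Variables (T : Type) (G : groupoid_data T).

Definition rng (g : T) : T := mul G g (inv G g).
Definition src (g : T) : T := mul G (inv G g) g.
Definition units : set T := range rng.

(** The product is associative, and inverses cancel on either side.  No axiom
    about [src] and [rng] is needed: see [composableP] and [units_src]. *)
Record is_groupoid : Prop := IsGroupoid {
  invK : forall g, inv G (inv G g) = g;
  composable_mul : forall g h k, composable G (g, h) -> composable G (h, k) ->
    [/\ composable G (mul G g h, k), composable G (g, mul G h k)
      & mul G (mul G g h) k = mul G g (mul G h k)];
  composable_invl : forall g, composable G (inv G g, g);
  mulKg : forall g h, composable G (g, h) -> mul G (inv G g) (mul G g h) = h;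
  composable_invr : forall g, composable G (g, inv G g);
  mulgK : forall g h, composable G (h, g) -> mul G (mul G h g) (inv G g) = h }.

Hypothesis hG : is_groupoid.

Lemma composableP (g h : T) : composable G (g, h) <-> src g = rng h.
Proof.
have mul_src x : composable G (x, src x) /\ mul G x (src x) = x.
  have [_ + _] := composable_mul hG (composable_invr hG x)
                                    (composable_invl hG x).
  split => //; rewrite /src.
  by have := mulKg hG (composable_invl hG x); rewrite (invK hG).
have rng_mul x : composable G (rng x, x).
  by have [+ _ _] := composable_mul hG (composable_invr hG x)
                                       (composable_invl hG x).
split=> [gh|gh].
  have [c1 _ e1] := composable_mul hG (composable_invl hG g) gh.
  have e2 : mul G (src g) h = h by rewrite /src e1 (mulKg hG gh).
  by rewrite /rng -[X in mul G X _]e2 (mulgK hG c1).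
have [cg eg] := mul_src g.
have ch : composable G (src g, h) by rewrite gh; exact: rng_mul.
by have [+ _ _] := composable_mul hG cg ch; rewrite eg.
Qed.

Lemma units_src : units = range src.
Proof.
by apply/seteqP; split=> _ [g _ <-]; exists (inv G g) => //;
  rewrite /rng /src (invK hG).
Qed.

End Groupoid.

(** * Topological groupoids *)

Section TopologicalGroupoid.
Variables (T : topologicalType) (G : groupoid_data T).

Record topological_groupoid : Prop := TopologicalGroupoid {
  is_groupoid_of : is_groupoid G;
  inv_continuous : continuous (inv G);
  mul_continuous :
    {within composable G, continuous (fun p : T * T => mul G p.1 p.2)} }.

Definition r_discrete : Prop := open (units G).

Definition rng_units (g : T) : units G :=
  SigSub (mem_set (imageT (rng G) g)).

End TopologicalGroupoid.

(** Every point has an open neighbourhood [U] with open image such that [f]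
    restricts to a homeomorphism from [U] onto [f @` U] (with inverse [k]). *)
Definition local_homeomorphism (X Y : topologicalType) (f : X -> Y) : Prop :=
  forall x : X, exists U : set X,
    [/\ open U, U x, open (f @` U), {within U, continuous f} &
        exists k : Y -> X,
          {in U, cancel f k} /\ {within f @` U, continuous k}].

Definition etale (T : topologicalType) (G : groupoid_data T) : Prop :=
  local_homeomorphism (@rng_units T G).

Definition topological_embedding (X Y : topologicalType) (i : X -> Y) : Prop :=
  injective i /\ @open X = [set i @^-1` W | W in @open Y].

(** [i] identifies the topological groupoid [G] with a subgroupoid of [H]
    carrying the subspace topology. *)
Record subgroupoid_inclusion (X Y : topologicalType) (G : groupoid_data X)
    (H : groupoid_data Y) (i : X -> Y) : Prop := SubgroupoidInclusion {
  incl_embedding : topological_embedding i;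
  incl_composable : forall g h, composable G (g, h) <-> composable H (i g, i h);
  incl_mul : forall g h, composable G (g, h) ->
    mul H (i g) (i h) = i (mul G g h);
  incl_inv : forall g, inv H (i g) = i (inv G g) }.

(** The library's compactification carries the topology of Alexandrov. *)
Lemma open_one_point_compactification (X : topologicalType)
    (U : set (one_point_compactification X)) :
  open U <->
  (exists2 V : set X, open V & U = Some @` V) \/
  (exists2 K : set X, closed K /\ compact K & U = Some @` (~` K) `|` [set None]).
Proof.
have preS : open U -> open (Some @^-1` U : set X).
  move=> oU; move/continuousP : (@one_point_compactification_some_continuous X).
  exact.
split=> [oU|[[V oV ->]|[K [clK cptK] ->]]].
- have [UN|UN] := pselect (U None); [right|left].
    have : nbhs (None : one_point_compactification X) U.
      exact: open_nbhs_nbhs.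
    move=> [K0 [cptK0 clK0] K0U].
    exists (~` (Some @^-1` U)).
      split; first exact: open_closedC (preS oU).
      apply: (subclosed_compact _ cptK0); first exact: open_closedC (preS oU).
      by move=> x nUx; apply: contrapT => nKx; apply: nUx; apply: K0U; left;
        exists x.
    rewrite setCK; apply/seteqP; split=> [[x|] Ux|_ [[x Ux <-]|->]] //.
      by left; exists x.
    by right.
  exists (Some @^-1` U); first exact: preS.
  by apply/seteqP; split=> [[x|] Ux|_ [x Ux <-]] //; exists x.
- exact: one_point_compactification_open_some.
- rewrite openE => -[x|] /= Ux.
    apply: (@filterS _ (nbhs (Some x : one_point_compactification X)) _
      (Some @` (~` K))); first by move=> y; left.
    apply: one_point_compactification_some_nbhs; apply: open_nbhs_nbhs.
    split; first exact: closed_openC.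
    by case: Ux => [[y + [<-]]|].
  by exists K.
Qed.

(** * The groupoid with a point added at infinity *)

Definition tilde (T : Type) (G : groupoid_data T) : Type := option T.

Section Tilde.
Variables (T : topologicalType) (G : groupoid_data T).

Definition tilde_incl : T -> tilde G := Some.

Definition units_plus : topologicalType := one_point_compactification (units G).
Definition units_plus_incl : units_plus -> tilde G := omap val.

Definition tilde_groupoid : groupoid_data (tilde G) := {|
  composable := [set p | match p with
                         | (Some g, Some h) => composable G (g, h)
                         | (None, None) => True
                         | _ => False
                         end];
  mul := fun x y => match x, y with
                    | Some g, Some h => Some (mul G g h)
                    | _, _ => None
                    end;
  inv := omap (inv G) |}.

Definition tilde_basis : set (set (tilde G)) :=
  [set setT]
  `|` [set units_plus_incl @` U | U in open]
  `|` [set tilde_incl @` U | U in open].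

HB.instance Definition _ := Choice.copy (tilde G) (option T).
(** The factory accepts any family of sets, and its topology is generated by
    that family as a subbase.  It is the only topology of which [tilde_basis]
    can be a basis. *)
HB.instance Definition _ :=
  isSubBaseTopological.Build (tilde G) tilde_basis id.

End Tilde.

Arguments tilde_incl {T} G _.
Arguments units_plus_incl {T} G _.
Arguments tilde_basis {T} G _.

(* Main.v *)
(** Because [units G] is open in [G], the inclusions of [G] and of
    [units_plus G] into [tilde G] are both open embeddings, and their images
    cover [tilde G].  Every assertion about [tilde G] is local, so it can be
    checked in [G] at the points of [G] and in [units_plus G] at infinity.
    There the structure is trivial: near infinity all elements are units, on
    which [rng] and [inv] are the identity and the product of two composable
    ones is their common value.  Infinity is separated from the points outside
    [units G] because [units G] is closed in [G], and from the units because
    [units_plus G] is Hausdorff. *)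

Require Import Defs.
From mathcomp Require Import all_boot finmap all_classical topology.

Set Implicit Arguments.
Unset Strict Implicit.
Unset Printing Implicit Defensive.

Local Open Scope classical_set_scope.

(** * Open embeddings and initial topologies *)

Definition open_embedding (X Y : topologicalType) (i : X -> Y) : Prop :=
  [/\ injective i, continuous i & forall U, open U -> open (i @` U)].

Lemma preimage_image_inj (X Y : Type) (i : X -> Y) (U : set X) :
  injective i -> i @^-1` (i @` U) = U.
Proof.
by move=> inj; apply/seteqP; split=> x; [move=> [y Uy /inj <-]|exists x].
Qed.

Lemma open_embedding_nbhs (X Y : topologicalType) (i : X -> Y) (x : X) :
  open_embedding i -> nbhs (i x) = i @ nbhs x.
Proof.
move=> [_ cont opn]; apply/seteqP; split=> W; first exact: cont.
rewrite /= nbhsE => -[V [oV Vx] VW].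
rewrite nbhsE; exists (i @` V); first by split; [exact: opn|exists x].
by move=> _ [y Vy <-]; exact: VW.
Qed.

Lemma topological_open_embedding (X Y : topologicalType) (i : X -> Y) :
  open_embedding i -> topological_embedding i.
Proof.
move=> [inj cont opn]; split=> //; apply/seteqP; split=> [U oU|_ [W oW <-]].
  by exists (i @` U); [exact: opn|exact: preimage_image_inj].
by move/continuousP : cont; apply.
Qed.

(** [hausdorff_space] says that two points related by [cluster (nbhs _)] coincide. Images of
    neighbourhoods under [i] are again neighbourhoods, and by injectivity a common point of two
    images comes from a common point in [X]. *)
Lemma open_embedding_cluster (X Y : topologicalType) (i : X -> Y) (x y : X) :
  open_embedding i -> hausdorff_space X ->
  cluster (nbhs (i x)) (i y) -> x = y.
Proof.
move=> emb hX cl; apply: hX => U V xU yV.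
have [] := cl (i @` U) (i @` V).
- by rewrite open_embedding_nbhs //; apply: filterS xU => z; exists z.
- by rewrite open_embedding_nbhs //; apply: filterS yV => z; exists z.
move=> _ [[u Uu <-] [v Vv]]; have [inj _ _] := emb.
by move=> /inj vu; exists u; split; rewrite // -vu.
Qed.

Lemma hausdorff_initial (X : choiceType) (Y : topologicalType) (i : X -> Y) :
  injective i -> hausdorff_space Y -> hausdorff_space (initial_topology i).
Proof.
move=> inj hY p q cl; apply/inj/hY => U V pU qV.
have [] := cl (i @^-1` U) (i @^-1` V); first exact: initial_continuous pU.
  exact: initial_continuous qV.
by move=> x [Ux Vx]; exists (i x).
Qed.

(** The image filter clusters at some [i x]; as the open sets of the initial topology are preimages,
    the original filter clusters at [x]. *)
Lemma compact_initial (X : choiceType) (Y : topologicalType) (i : X -> Y)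
    (A : set X) :
  compact (i @` A) -> compact (A : set (initial_topology i)).
Proof.
move=> cA F FF FA.
have FiA : (i @ F) (i @` A) by apply: (@filterS _ F) FA => x; exists x.
have [_ [[x Ax <-] cl]] := cA _ _ FiA.
exists x; split=> // B N FB [_ [[V oV <-] Vx VN]].
have [] := cl (i @` B) V; first by apply: (@filterS _ F) FB => y; exists y.
  exact: open_nbhs_nbhs.
by move=> _ [[y By <-] Vy]; exists y; split=> //; exact: VN.
Qed.

Lemma val_open_embedding (X : topologicalType) (A : set X) :
  open A -> open_embedding (val : A -> X).
Proof.
move=> oA; split; first exact: val_inj.
  exact: initial_continuous.
move=> _ [V oV <-]; rewrite (_ : _ @` _ = A `&` V); first exact: openI.
apply/seteqP; split=> [_ [x Vx <-]|x [Ax Vx]].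
  by split=> //; exact: set_mem (valP x).
by exists (SigSub (mem_set Ax)).
Qed.

Lemma locally_compact_closed_subtype (X : topologicalType) (A : set X) :
  hausdorff_space X -> closed A -> locally_compact [set: X] ->
  locally_compact [set: A].
Proof.
move=> hX clA lcX x _.
have [U] := lcX (val x) I; rewrite withinET => xU [cU clU].
exists (val @^-1` U : set A).
  by rewrite withinET; exact: initial_continuous xU.
split; last first.
  exact: (continuous_closedP (val : A -> X)).1 (@initial_continuous A X val)
    _ clU.
apply: compact_initial.
rewrite (_ : _ @` _ = U `&` A); first exact: compact_closedI.
apply/seteqP; split=> [_ [y Uy <-]|y [Uy Ay]].
  by split=> //; exact: set_mem (valP y).
by exists (SigSub (mem_set Ay)).
Qed.


Lemma finI_from_open (X : topologicalType) (I : choiceType) (D : set I)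
    (b : I -> set X) :
  (forall i, D i -> open (b i)) -> finI_from D b `<=` open.
Proof.
move=> bo _ [E ED <-]; rewrite openE => x Ex; apply: filter_bigI => i Ei.
apply: open_nbhs_nbhs; split; last exact: Ex.
by apply: bo; exact: set_mem (ED _ Ei).
Qed.

(** * Algebra of units *)

Section GroupoidUnits.
Variables (T : Type) (G : groupoid_data T).
Hypothesis hG : is_groupoid G.

(** A unit has the form [src G g], and [g] is composable with it; composability equates [src G g]
    with the range of that unit. *)
Lemma rng_unit (u : T) : units G u -> rng G u = u.
Proof.
rewrite (units_src hG) => -[g _ <-]; apply/esym/(composableP hG).
by have [_ + _] := composable_mul hG (composable_invr hG g)
                                  (composable_invl hG g).
Qed.

Lemma src_unit (u : T) : units G u -> src G u = u.
Proof.
move=> [g _ <-]; apply/(composableP hG).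
by have [+ _ _] := composable_mul hG (composable_invr hG g)
                                  (composable_invl hG g).
Qed.

Lemma mul_src (g : T) : Defs.mul G g (src G g) = g.
Proof.
by have := Defs.mulKg hG (composable_invl hG g); rewrite (Defs.invK hG).
Qed.

Lemma mul_units (u v : T) : units G u -> units G v -> composable G (u, v) ->
  Defs.mul G u v = u.
Proof.
move=> uG vG /(composableP hG); rewrite (rng_unit vG) => <-.
exact: mul_src.
Qed.

Lemma inv_unit (u : T) : units G u -> Defs.inv G u = u.
Proof.
(* In formulas, [u^-1 = u^-1 (u u^-1) = u^-1 u = u]. *)
move=> uG; rewrite -[LHS]mul_src /src (Defs.invK hG) -/(rng G u) rng_unit//.
exact: src_unit.
Qed.

End GroupoidUnits.

(** * Range map and unit space of a topological groupoid *)

Lemma rng_continuous (T : topologicalType) (G : groupoid_data T) :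
  topological_groupoid G -> continuous (rng G).
Proof.
move=> [hG ci /subspace_continuousP cm] g.
(* The range is the product after [g |-> (g, g^-1)], which takes values in [composable G], so
   continuity of the product within that set suffices. *)
apply: cvg_trans (cm (g, Defs.inv G g) (composable_invr hG g)).
move=> W [[P Q] /= [Pg Qg] PQW].
have Qig : nbhs g (Defs.inv G @^-1` Q) by exact: ci.
apply: filterS (filterI Pg Qig) => h [Ph Qh].
by apply: (PQW (h, Defs.inv G h)); [split|exact: composable_invr].
Qed.

(** The units are the fixed points of the continuous map [rng G], hence closed in a Hausdorff
    space. *)
Lemma units_closed (T : topologicalType) (G : groupoid_data T) :
  topological_groupoid G -> hausdorff_space T -> closed (units G).
Proof.
move=> topG hT g clg; suff <- : rng G g = g by exists g.
apply: hT => U V Ug Vg.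
have rU : nbhs g (rng G @^-1` U) by exact: rng_continuous.
have [u [uG [Uu Vu]]] := clg _ (filterI rU Vg).
by exists u; split=> //; rewrite -(rng_unit (is_groupoid_of topG) uG).
Qed.

Lemma rng_units_continuous (T : topologicalType) (G : groupoid_data T) :
  topological_groupoid G -> continuous (@rng_units T G).
Proof.
move=> topG.
exact: (@continuous_comp_initial (units G) T T val (@rng_units T G)
  (rng_continuous topG)).
Qed.

(** * Topology of [tilde G] *)

Section Tilde.
Variables (T : topologicalType) (G : groupoid_data T).

Lemma tilde_basis_open (B : set (tilde G)) : tilde_basis G B -> open B.
Proof.
move=> bB; exists [set B]; last by rewrite bigcup_set1.
move=> _ ->; exists [fset B]%fset; first by move=> C /fset1P ->; rewrite inE.
by rewrite set_fset1 bigcap_set1.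
Qed.

(** Open sets are unions of finite intersections of members of [tilde_basis G], and preimages
    commute with both operations. *)
Lemma tilde_continuousP (X : topologicalType) (f : X -> tilde G) :
  (forall B, tilde_basis G B -> open (f @^-1` B)) -> continuous f.
Proof.
move=> fB; apply/continuousP => _ [D DB <-].
rewrite preimage_bigcup; apply: bigcup_open => A /DB[E EB <-].
rewrite preimage_bigcap; apply: (finI_from_open fB).
by exists E.
Qed.

Lemma tilde_incl_inj : injective (tilde_incl G).
Proof. by move=> g h []. Qed.

Lemma units_plus_incl_inj : injective (units_plus_incl G).
Proof. by move=> [u|] [v|] //= [/val_inj ->]. Qed.

Hypothesis G_rdisc : r_discrete G.

(** An open set of [units_plus G] leaves in [G] an open subset of [units G], which is open in [G] by
    r-discreteness. *)
Lemma tilde_incl_open_embedding : open_embedding (tilde_incl G).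
Proof.
split; first exact: tilde_incl_inj.
- apply: tilde_continuousP => _ [[->|[U oU <-]]|[U oU <-]].
  + exact: openT.
  + rewrite (_ : _ @^-1` _ = val @` (Some @^-1` U)).
      have [_ _] := val_open_embedding G_rdisc; apply.
      have /continuousP := @one_point_compactification_some_continuous (units G).
      exact.
    apply/seteqP; split=> [g [[u|] // Uu [<-]]|_ [u Uu <-]].
      by exists u.
    by exists (Some u).
  + by rewrite preimage_image_inj //; exact: tilde_incl_inj.
- by move=> U oU; apply: tilde_basis_open; right; exists U.
Qed.

Lemma units_plus_incl_open_embedding : open_embedding (units_plus_incl G).
Proof.
split; first exact: units_plus_incl_inj.
- apply: tilde_continuousP => _ [[->|[U oU <-]]|[U oU <-]].
  + exact: openT.
  + by rewrite preimage_image_inj //; exact: units_plus_incl_inj.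
  + rewrite (_ : _ @^-1` _ = Some @` (val @^-1` U)).
      apply: one_point_compactification_open_some.
      by move/continuousP: (@initial_continuous (units G) T val); apply.
    apply/seteqP; split=> [[u|] [g Ug //= [gu]]|_ [u Uu <-]].
      by exists u; rewrite //= -gu.
    by exists (val u).
- by move=> U oU; apply: tilde_basis_open; left; right; exists U.
Qed.

Lemma basis_tilde : basis (tilde_basis G).
Proof.
split; first exact: tilde_basis_open.
move=> x W; rewrite nbhsE => -[V [oV Vx] VW].
have [_ /continuousP ci _] := tilde_incl_open_embedding.
have [_ /continuousP cu _] := units_plus_incl_open_embedding.
case: x Vx => [g|] Vx.
  (* The part of [V] inside [G] is already a member of the basis; at infinity the part inside
     [units_plus G] takes its place. *)
  exists (tilde_incl G @` (tilde_incl G @^-1` V)).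
    split; last by exists g.
    by right; exists (tilde_incl G @^-1` V); first exact: ci.
  by apply: subset_trans VW; exact: image_preimage_subset.
exists (units_plus_incl G @` (units_plus_incl G @^-1` V)).
  split; last by exists None.
  by left; right; exists (units_plus_incl G @^-1` V); first exact: cu.
by apply: subset_trans VW; exact: image_preimage_subset.
Qed.

(** * Groupoid structure of [tilde G] *)

Lemma rng_tilde : rng (tilde_groupoid G) = omap (rng G).
Proof. by apply/funext => -[]. Qed.

Lemma src_tilde : src (tilde_groupoid G) = omap (src G).
Proof. by apply/funext => -[]. Qed.

Lemma units_tilde : units (tilde_groupoid G) = range (units_plus_incl G).
Proof.
rewrite /units rng_tilde; apply/seteqP; split=> _ [x _ <-].
  by case: x => [g|]; [exists (Some (rng_units G g))|exists None].
case: x => [u|]; last by exists None.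
by have [g _ gu] := set_mem (valP u); exists (Some g); rewrite //= gu.
Qed.

Lemma tilde_is_groupoid : is_groupoid G -> is_groupoid (tilde_groupoid G).
Proof.
move=> hG; split.
- by move=> [g|] //=; rewrite (Defs.invK hG).
- move=> [g|] [h|] [k|] //= gh hk.
  by have [? ? ->] := composable_mul hG gh hk.
- by move=> [g|] //=; exact: composable_invl.
- by move=> [g|] [h|] //= gh; rewrite Defs.mulKg.
- by move=> [g|] //=; exact: composable_invr.
- by move=> [g|] [h|] //= hg; rewrite Defs.mulgK.
Qed.

Lemma nbhs_tilde_None : nbhs (None : tilde G) (range (units_plus_incl G)).
Proof.
have [_ _ oi] := units_plus_incl_open_embedding.
by apply: open_nbhs_nbhs; split; [exact: (oi _ openT)|exists None].
Qed.

Lemma tilde_topological_groupoid :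
  topological_groupoid G -> topological_groupoid (tilde_groupoid G).
Proof.
move=> topG; have hG := is_groupoid_of topG; split.
- exact: tilde_is_groupoid.
- move=> [g|] W.
    rewrite (open_embedding_nbhs (Defs.inv G g) tilde_incl_open_embedding).
    move=> /(inv_continuous topG) WN.
    suff: nbhs (tilde_incl G g) (Defs.inv (tilde_groupoid G) @^-1` W) by [].
    by rewrite (open_embedding_nbhs g tilde_incl_open_embedding).
  (* Intersecting [W] with the units and infinity leaves only points fixed by inversion. *)
  move=> WN; apply: filterS (filterI nbhs_tilde_None WN) => _ [[[u|] _ <-]] //.
  by rewrite /= inv_unit //; exact: set_mem (valP u).
- apply/subspace_continuousP => -[[g|] [h|]] //= gh W.
    rewrite (open_embedding_nbhs _ tilde_incl_open_embedding) => WN.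
    have /subspace_continuousP/(_ _ gh) := mul_continuous topG.
    move=> /(_ _ WN)[[P Q] /= [Pg Qh] PQW].
    exists (tilde_incl G @` P, tilde_incl G @` Q).
      split=> /=; rewrite (open_embedding_nbhs _ tilde_incl_open_embedding).
        by apply: filterS Pg => x; exists x.
      by apply: filterS Qh => x; exists x.
    by move=> [_ _] /= [[x Px <-] [y Qy <-]] xy; exact: (PQW (x, y)).
  move=> WN.
  (* Only the first factor is confined to [W]: the product of composable units is the first
     factor. *)
  exists (W `&` range (units_plus_incl G), range (units_plus_incl G)).
    by split; [apply: filterI => //|]; exact: nbhs_tilde_None.
  move=> [a b] /= [[Wa [x _ xa]] [y _ <-]]; rewrite -{a}xa in Wa *.
  case: x y Wa => [u|] [v|] //= Wu uv.
  rewrite /from_subspace /= mul_units //; exact: set_mem (valP _).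
Qed.

(** * Separation and compactness *)

Lemma tilde_hausdorff : topological_groupoid G -> locally_compact [set: T] ->
  hausdorff_space T -> hausdorff_space (tilde G).
Proof.
move=> topG lcT hT.
have clG := units_closed topG hT.
(* The compactification is Hausdorff because [units G], closed in [G], inherits local compactness
   and the Hausdorff property. *)
have hU : hausdorff_space (units_plus G).
  apply: one_point_compactification_hausdorff.
    exact: locally_compact_closed_subtype.
  by apply: hausdorff_initial; first exact: val_inj.
have emb := tilde_incl_open_embedding.
have NSome g : ~ cluster (nbhs (None : tilde G)) (Some g).
  move=> cl; have [gG|gG] := pselect (units G g).
    pose u : units G := SigSub (mem_set gG).
    by have := @open_embedding_cluster (units_plus G) (tilde G) _ None (Some u)
      units_plus_incl_open_embedding hU cl.
  (* For a non-unit [g], the image of [units_plus G] and the complement of [units G] in [G] are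
     disjoint neighbourhoods of infinity and [g]. *)
  have [] := cl (range (units_plus_incl G)) (tilde_incl G @` (~` units G)).
  - exact: nbhs_tilde_None.
  - have [_ _ oi] := emb; apply: open_nbhs_nbhs; split; last by exists g.
    exact/oi/closed_openC.
  move=> _ [[[u|] _ <-] [h hG //= [hu]]]; apply: hG; rewrite hu.
  exact: set_mem (valP u).
move=> [g|] [h|] //.
- by move=> cl; congr Some; exact: open_embedding_cluster emb hT cl.
- by move=> cl; case: (NSome g) => U V hU' hV; rewrite setIC; exact: cl.
- by move/NSome.
Qed.

Lemma units_tilde_compact : compact (units (tilde_groupoid G)).
Proof.
rewrite units_tilde; have [_ ci _] := units_plus_incl_open_embedding.
apply: continuous_compact; first exact: continuous_subspaceT.
exact: one_point_compactification_compact.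
Qed.

Lemma units_tilde_open : r_discrete (tilde_groupoid G).
Proof.
rewrite /r_discrete units_tilde.
by have [_ _ oi] := units_plus_incl_open_embedding; exact: (oi _ openT).
Qed.

(** Compact neighbourhoods of points of [G] are carried over by [tilde_incl]; at infinity the
    compact open unit space serves. *)
Lemma tilde_locally_compact : locally_compact [set: T] ->
  hausdorff_space (tilde G) -> locally_compact [set: tilde G].
Proof.
move=> lcT hG [g|] _; rewrite withinET.
  have [U] := lcT g I; rewrite withinET => gU [cU _].
  have [_ ci _] := tilde_incl_open_embedding.
  have cK : compact (tilde_incl G @` U).
    by apply: continuous_compact => //; exact: continuous_subspaceT.
  exists (tilde_incl G @` U); last by split=> //; exact: compact_closed.
  rewrite (open_embedding_nbhs _ tilde_incl_open_embedding).
  by apply: filterS gU => x; exists x.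
exists (units (tilde_groupoid G)).
  by rewrite units_tilde; exact: nbhs_tilde_None.
have cK := units_tilde_compact.
by split=> //; exact: compact_closed.
Qed.

(** * Inclusion of [G] and etaleness *)

Lemma tilde_subgroupoid_inclusion :
  subgroupoid_inclusion G (tilde_groupoid G) (tilde_incl G).
Proof.
split=> //; apply: topological_open_embedding.
exact: tilde_incl_open_embedding.
Qed.

(** The value is [tilde_incl G (val u)]: see [val_tilde_unit]. *)
Definition tilde_unit (u : units G) : units (tilde_groupoid G) :=
  rng_units (tilde_groupoid G) (tilde_incl G (val u)).

Lemma val_tilde_unit (u : units G) : is_groupoid G ->
  val (tilde_unit u) = tilde_incl G (val u).
Proof.
by move=> hG; have /(congr1 (tilde_incl G)) := rng_unit hG (set_mem (valP u)).
Qed.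

Lemma rng_units_tilde (g : T) : is_groupoid G ->
  rng_units (tilde_groupoid G) (tilde_incl G g) = tilde_unit (rng_units G g).
Proof.
by move=> hG; apply: val_inj; rewrite val_tilde_unit.
Qed.

(** This transfers local inverses of the range map from [units G] to [units (tilde_groupoid G)]. The
    image of an open [U] is the trace of the open set [tilde_incl G @] (val @[U)]. *)
Lemma tilde_unit_open_embedding :
  topological_groupoid G -> open_embedding tilde_unit.
Proof.
move=> topG; have hG := is_groupoid_of topG.
have [vinj vcont vopn] := val_open_embedding G_rdisc.
have [_ icont iopn] := tilde_incl_open_embedding.
split.
- move=> u v /(congr1 val); rewrite !val_tilde_unit //.
  by move=> /tilde_incl_inj/vinj.
- move=> u.
  apply: (@continuous_comp (units G) (tilde G) (units (tilde_groupoid G))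
    (tilde_incl G \o val) (rng_units (tilde_groupoid G))).
    exact: continuous_comp (vcont u) (icont _).
  exact: rng_units_continuous (tilde_topological_groupoid topG) _.
- move=> U oU; exists (tilde_incl G @` (val @` U)); first exact/iopn/vopn.
  apply/seteqP; split=> [y [_ [u Uu <-] uy]|_ [u Uu <-]].
    by exists u => //; apply: val_inj; rewrite val_tilde_unit.
  by exists (val u); [exists u|exact/esym/val_tilde_unit].
Qed.

Lemma tilde_etale :
  topological_groupoid G -> etale G -> etale (tilde_groupoid G).
Proof.
move=> topG etG; have hG := is_groupoid_of topG.
have cr := rng_units_continuous (tilde_topological_groupoid topG).
have hH := tilde_is_groupoid hG.
move=> [g|].
  have [U [oU Ug oRU _ [k [kK ck]]]] := etG g.
  pose V := @rng_units T G @` U.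
  have imV : @rng_units _ (tilde_groupoid G) @` (tilde_incl G @` U) =
      tilde_unit @` V.
    rewrite /V !image_comp; apply: eq_imagel => h _.
    exact: rng_units_tilde.
  have [_ _ uopn] := tilde_unit_open_embedding topG.
  have [_ icont iopn] := tilde_incl_open_embedding.
  (* The value of [y] lies in [option T]; [rng_units] turns a finite one, which is a unit, back into
     an element of the subtype on which [k] is defined. *)
  pose k' (y : units (tilde_groupoid G)) : tilde G :=
    omap (k \o @rng_units T G) (val y).
  have k'E u : k' (tilde_unit u) = tilde_incl G (k u).
    rewrite /k' val_tilde_unit //=; congr (Some (k _)).
    apply: val_inj => /=; rewrite rng_unit //; exact: set_mem (valP u).
  exists (tilde_incl G @` U); split.
  - exact: iopn.
  - by exists g.
  - by rewrite imV; exact: uopn.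
  - exact: continuous_subspaceT.
  exists k'; split.
    move=> x /set_mem [h Uh <-]; rewrite rng_units_tilde // k'E kK //.
    exact: mem_set.
  rewrite imV continuous_open_subspace; last exact: uopn.
  move=> y /set_mem [u Vu <-] W.
  (* Continuity is tested through [tilde_unit], along which [k'] becomes [tilde_incl G \o k]. *)
  rewrite k'E (open_embedding_nbhs u (tilde_unit_open_embedding topG)).
  move: ck; rewrite continuous_open_subspace // => /(_ u (mem_set Vu)) ck.
  move=> /icont/ck kW.
  have {}kW : nbhs u ((tilde_incl G \o k) @^-1` W) := kW.
  suff: nbhs u (tilde_unit @^-1` (k' @^-1` W)) by [].
  by apply: filterS kW => v /=; rewrite k'E.
(* At infinity the whole unit space is the required open set: the range map fixes it pointwise, and
   [val] is the inverse. *)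
exists (units (tilde_groupoid G)); split.
- exact: units_tilde_open.
- by rewrite units_tilde; exists None.
- rewrite (_ : _ @` _ = setT); first exact: openT.
  apply/seteqP; split=> // y _; exists (val y); first exact: set_mem (valP y).
  by apply: val_inj; exact: (rng_unit hH (set_mem (valP y))).
- exact: continuous_subspaceT.
exists val; split; first by move=> x /set_mem xG; exact: (rng_unit hH xG).
by apply: continuous_subspaceT; exact: initial_continuous.
Qed.

End Tilde.

Theorem lemma3p4 (T : topologicalType) (G : groupoid_data T)
    (G_top : topological_groupoid G)
    (G_lc : locally_compact [set: T])
    (G_hausdorff : hausdorff_space T)
    (G_rdisc : r_discrete G)
    (G0_noncompact : ~ compact (units G)) :
  [/\ basis (tilde_basis G),
      [/\ topological_groupoid (tilde_groupoid G),
          locally_compact [set: tilde G],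
          hausdorff_space (tilde G),
          r_discrete (tilde_groupoid G) &
          compact (units (tilde_groupoid G))],
      [/\ rng (tilde_groupoid G) = omap (rng G),
          src (tilde_groupoid G) = omap (src G),
          units (tilde_groupoid G) = range (units_plus_incl G) &
          topological_embedding (units_plus_incl G)],
      subgroupoid_inclusion G (tilde_groupoid G) (tilde_incl G) &
      etale G -> etale (tilde_groupoid G)].
Proof.
have hG := is_groupoid_of G_top.
have hT := tilde_hausdorff G_rdisc G_top G_lc G_hausdorff.
split.
- exact: basis_tilde.
- split=> //.
  + exact: tilde_topological_groupoid.
  + exact: tilde_locally_compact.
  + exact: units_tilde_open.
  + exact: units_tilde_compact.
- split.
  + exact: rng_tilde.
  + exact: src_tilde.
  + exact: units_tilde.
  + exact/topological_open_embedding/units_plus_incl_open_embedding.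
- exact: tilde_subgroupoid_inclusion.
- exact: tilde_etale.
Qed.
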